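(* Let $\pi_H=\{N^H_1\le\dots\le N^H_r\}$ and $\pi_K=\{N^K_1\le\dots\le N^K_s\}$ be two non-decreasing partitions of $N$. Let $H=O(N^H_1)\times\dots\times O(N^H_r)$, $K=O(N^K_1)\times\dots\times O(N^K_s)$ be the associated maximal orthogonal Borel subgroups of $O(N)$, correspondingly $H=SO(N^H_1)\times\dots\times SO(N^H_r)$, $K=SO(N^K_1)\times\dots\times SO(N^K_s)$ the maximal connected orthogonal Borel subgroups. Split the two sequences into successive intervals of indices as follows: let $0=S_0<S_1<\dots<S_m=N$ be all the common partial sums of $\pi_H$ and $\pi_K$, i.e. all numbers of the form $\sum_{j=1}^{c}N^H_j=\sum_{i=1}^{d}N^K_i$ for some $0\le c\le r$, $0\le d\le s$. For each $1\le l\le m$, the parts of $\pi_H$ and of $\pi_K$ lying between $S_{l-1}$ and $S_l$ either consist of one and the same single part $S_l-S_{l-1}$ in both partitions (the partitions are equal there), or are two non-commensurable partitions of $S_l-S_{l-1}$, i.e. without common proper partial sums. Then the group $\langle H,K\rangle$ is equal to the product which has a factor $O(N^H_j)$ for each part where the partitions are equal and a factor $O(S_l-S_{l-1})$ for each interval where the partitions are non-commensurable, i.e. $$\langle H,K\rangle=O(S_1-S_0)\times O(S_2-S_1)\times\dots\times O(S_m-S_{m-1}).$$ Moreover, the corresponding statement holds in the connected case, with $SO$ in place of $O$.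
   Context: All product groups act blockwise on $\mathbb{R}^N$, on consecutive blocks of coordinates with respect to one fixed orthonormal basis of $\mathbb{R}^N$. Partitions are sequences of positive integers with sum $N$. $\langle H,K\rangle$ is the closed subgroup of $O(N)$ topologically generated by $H$ and $K$. *)

(* Defs.v *)
From HB Require Import structures.
From mathcomp Require Import all_boot all_order all_algebra.
From mathcomp Require Import all_classical all_reals all_analysis.

Set Implicit Arguments.
Unset Strict Implicit.
Unset Printing Implicit Defensive.

Import Order.TTheory GRing.Theory Num.Theory.
Import numFieldNormedType.Exports.

Local Open Scope classical_set_scope.
Local Open Scope ring_scope.

Definition is_partition (N : nat) (p : seq nat) : Prop :=
  all (fun n => 0 < n)%N p /\ sumn p = N.

Definition partial_sums (p : seq nat) : seq nat :=
  [seq sumn (take c p) | c <- iota 0 (size p).+1].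

(* The sequence S_0, ..., S_m, of size m + 1. *)
Definition common_sums (p q : seq nat) : seq nat :=
  [seq k <- partial_sums p | k \in partial_sums q].

(* The sequence S_1 - S_0, ..., S_m - S_(m-1). *)
Definition gaps (S : seq nat) : seq nat :=
  mkseq (fun l => nth 0 S l.+1 - nth 0 S l)%N (size S).-1.

Definition parts_between (p : seq nat) (a b : nat) : seq nat :=
  [seq nth 0%N p j | j <- iota 0 (size p) &
     (a <= sumn (take j p))%N && (sumn (take j.+1 p) <= b)%N].

Definition non_commensurable (n : nat) (p q : seq nat) : Prop :=
  [/\ is_partition n p, is_partition n q &
      forall k, k \in partial_sums p -> k \in partial_sums q ->
        k = 0%N \/ k = n].

Definition orthogonal_group (R : realType) (n : nat) : set 'M[R]_n :=
  [set A | A *m A^T = 1%:M].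

Definition special_orthogonal_group (R : realType) (n : nat) : set 'M[R]_n :=
  [set A | A *m A^T = 1%:M /\ \det A = 1].

Arguments orthogonal_group : clear implicits.
Arguments special_orthogonal_group : clear implicits.

(* G(p_1) x ... x G(p_r) acting blockwise on R^N: block-diagonal matrices with
   i-th block in G(p_i).  The equation [e] only transports [\mxdiag] from size
   p_1 + ... + p_r to size N; the set is empty when p does not sum to N. *)
Definition block_product (R : realType) (G : forall n, set 'M[R]_n)
    (N : nat) (p : seq nat) : set 'M[R]_N :=
  [set A | exists (e : (\sum_(i < size p) nth 0 p i)%N = N)
                  (B : forall i : 'I_(size p), 'M[R]_(nth 0%N p i)),
     (forall i, G _ (B i)) /\ A = castmx (e, e) (\mxdiag_i B i)].

Arguments block_product {R} G N p _.

(* O(N) is closed in the space of matrices, so a subset of O(N) is closed in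
   O(N) if and only if it is closed as a set of matrices. *)
Definition closed_subgroup_O (R : realType) (N : nat)
    (G : set 'M[R]_N) : Prop :=
  [/\ G `<=` orthogonal_group R N, G 1%:M,
      forall A B, G A -> G B -> G (A *m B),
      forall A, G A -> G (invmx A) & closed G].

Definition topologically_generated (R : realType) (N : nat)
    (H K : set 'M[R]_N) : set 'M[R]_N :=
  smallest (@closed_subgroup_O R N) (H `|` K).

(* Main.v *)
(* A rotation in the plane of two adjacent coordinates k, k+1 lies in a block
   product as soon as no partial sum of the partition separates the two
   coordinates.  Row reduction shows that such rotations generate
   SO(n_1) x ... x SO(n_r), and that together with the coordinate reflections
   they generate O(n_1) x ... x O(n_r).  A cut that is not common to both
   partitions is missing in one of them, so every rotation generating the
   product over the gaps already lies in H or in K. *)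
Require Import Defs.
From HB Require Import structures.
From mathcomp Require Import all_boot all_order all_algebra.
From mathcomp Require Import all_classical all_reals all_analysis.
From mathcomp Require Import zify lra.

Set Implicit Arguments.
Unset Strict Implicit.
Unset Printing Implicit Defensive.

Import Order.TTheory GRing.Theory Num.Theory.
Import numFieldNormedType.Exports.

Local Open Scope classical_set_scope.
Local Open Scope ring_scope.

(** * Partial sums, common cuts and gaps of partitions *)

Lemma size_partial_sums (p : seq nat) : size (partial_sums p) = (size p).+1.
Proof. by rewrite size_map size_iota. Qed.

Lemma partial_sums_cons (x : nat) (p : seq nat) :
  partial_sums (x :: p) = 0%N :: map (addn x) (partial_sums p).
Proof.
rewrite /partial_sums -[iota 0 _]/(0%N :: iota (1 + 0) (size p).+1).
by rewrite iotaDl map_cons -!map_comp.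
Qed.

Lemma nth_partial_sums (p : seq nat) (c : nat) :
  (c <= size p)%N -> nth 0%N (partial_sums p) c = sumn (take c p).
Proof. by move=> cp; rewrite (nth_map 0%N) ?size_iota ?nth_iota. Qed.

Lemma partial_sumsP (p : seq nat) (k : nat) :
  reflect (exists2 c, (c <= size p)%N & k = sumn (take c p))
          (k \in partial_sums p).
Proof.
apply: (iffP mapP) => -[c]; first by rewrite mem_iota ltnS => /= ? ->; exists c.
by move=> ? ->; exists c; rewrite // mem_iota ltnS.
Qed.

Lemma partial_sums0 (p : seq nat) : 0%N \in partial_sums p.
Proof. by apply/partial_sumsP; exists 0%N; rewrite ?take0. Qed.

Lemma partial_sums_sumn (p : seq nat) : sumn p \in partial_sums p.
Proof. by apply/partial_sumsP; exists (size p); rewrite ?take_size. Qed.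

Lemma partial_sumsE (p : seq nat) :
  exists s, partial_sums p = rcons s (sumn p).
Proof.
exists (map (fun c => sumn (take c p)) (iota 0 (size p))).
by rewrite /partial_sums -addn1 iotaD map_cat /= cats1 add0n take_size.
Qed.

Lemma sorted_partial_sums (p : seq nat) :
  all (fun n => 0 < n)%N p -> sorted ltn (partial_sums p).
Proof.
elim: p => [//|x p IH] /andP[x0 /IH sp].
rewrite partial_sums_cons -[sorted _ _]/(path ltn 0%N _) path_min_sorted.
  by rewrite sorted_map (@eq_sorted _ _ ltn) // => i j /=; rewrite ltn_add2l.
by apply/allP => _ /mapP[k _ ->]; rewrite /= ltn_addr.
Qed.

(** Positive parts make the partial sums strictly increasing, so comparing them amounts to comparing
    indices. *)
Lemma leq_sumn_take (p : seq nat) (i j : nat) :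
  all (fun n => 0 < n)%N p -> (i <= size p)%N -> (j <= size p)%N ->
  (sumn (take i p) <= sumn (take j p))%N = (i <= j)%N.
Proof.
move=> p0 ip jp.
have lt a b : (a < b)%N -> (b <= size p)%N ->
    (sumn (take a p) < sumn (take b p))%N.
  move=> ab bp; rewrite -!nth_partial_sums ?(leq_trans (ltnW ab)) //.
  by apply: (sorted_ltn_nth ltn_trans 0%N (sorted_partial_sums p0));
    rewrite ?inE ?size_partial_sums ?ltnS ?(leq_trans (ltnW ab)).
case: (ltngtP i j) => [ij|ji|->]; last exact: leqnn.
  exact: ltnW (lt _ _ ij jp).
by apply/negbTE; rewrite -ltnNge lt.
Qed.

(** A prefix of the slice, put after the first [c] parts, is again a prefix of [p]. *)
Lemma mem_partial_sums_slice (p : seq nat) (c d k : nat) :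
  (c <= d)%N -> (d <= size p)%N ->
  k \in partial_sums (take (d - c) (drop c p)) ->
  (sumn (take c p) + k)%N \in partial_sums p.
Proof.
move=> cd dp /partial_sumsP[t]; rewrite size_takel ?size_drop ?leq_sub2r //.
move=> tdc ->.
apply/partial_sumsP; exists (c + t)%N; first by lia.
by rewrite takeD sumn_cat take_takel.
Qed.

Lemma sumn_slice (p : seq nat) (c d : nat) :
  (c <= d)%N ->
  sumn (take (d - c) (drop c p)) = (sumn (take d p) - sumn (take c p))%N.
Proof. by move=> cd; rewrite -{2}(subnKC cd) takeD sumn_cat addKn. Qed.

Lemma parts_betweenE (p : seq nat) (c d : nat) :
  all (fun n => 0 < n)%N p -> (c <= d)%N -> (d <= size p)%N ->
  parts_between p (sumn (take c p)) (sumn (take d p)) = take (d - c) (drop c p).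
Proof.
move=> p0 cd dp; rewrite /parts_between.
rewrite (@eq_in_filter _ _ [pred j | (c <= j < d)%N]); last first.
  move=> j; rewrite mem_iota /= => jp.
  by rewrite !leq_sumn_take // ?(leq_trans cd) // ltnW.
rewrite -(map_nth_iota 0%N) ?leq_sub2r //; congr map.
(* Both index lists are strictly increasing, so having the same members makes them equal. *)
apply: (irr_sorted_eq ltn_trans ltnn); rewrite ?iota_ltn_sorted //.
  exact/(sorted_filter ltn_trans)/iota_ltn_sorted.
by move=> j; rewrite mem_filter /= !mem_iota; lia.
Qed.

(** The list of partial sums starts with 0 and ends with the total; both are common to [p] and [q],
    so filtering keeps the two ends as well as the order. *)
Lemma common_sumsE (N : nat) (p q : seq nat) :
  is_partition N p -> is_partition N q ->
  [/\ nth 0%N (common_sums p q) 0 = 0%N,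
      nth 0%N (common_sums p q) (size (common_sums p q)).-1 = N,
      sorted ltn (common_sums p q) & (0 < size (common_sums p q))%N].
Proof.
move=> [p0 pN] [q0 qN]; have szS : (0 < size (common_sums p q))%N.
  rewrite lt0n size_eq0; apply/eqP => S0.
  have : 0%N \in common_sums p q by rewrite mem_filter !partial_sums0.
  by rewrite S0.
split => //.
- rewrite /common_sums; case: p {p0 pN szS} => [|x p].
    by rewrite /partial_sums /= partial_sums0.
  by rewrite partial_sums_cons -cat1s filter_cat /= partial_sums0.
- rewrite nth_last /common_sums; have [s ->] := partial_sumsE p.
  by rewrite filter_rcons pN -{1}qN partial_sums_sumn last_rcons.
- exact/(sorted_filter ltn_trans)/sorted_partial_sums.
Qed.

(** The differences telescope; since [S] increases, the truncated subtraction in [gaps] is a true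
    one. *)
Lemma partial_sums_gaps (S : seq nat) :
  nth 0%N S 0 = 0%N -> (0 < size S)%N -> sorted ltn S ->
  partial_sums (gaps S) = S.
Proof.
move=> S0 szS sS; have szg : size (gaps S) = (size S).-1 by rewrite size_mkseq.
apply: (@eq_from_nth _ 0%N); first by rewrite size_partial_sums szg prednK.
move=> i; rewrite size_partial_sums ltnS => ig; rewrite nth_partial_sums //.
elim: i ig => [|i IH] ig; first by rewrite take0.
rewrite (take_nth 0%N) // sumn_rcons IH ?(ltnW ig) // nth_mkseq -?szg // subnKC //.
apply/ltnW/(sorted_ltn_nth ltn_trans 0%N sS); rewrite ?inE //; lia.
Qed.

Lemma is_partition_gaps (N : nat) (S : seq nat) :
  nth 0%N S 0 = 0%N -> nth 0%N S (size S).-1 = N -> (0 < size S)%N ->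
  sorted ltn S -> is_partition N (gaps S).
Proof.
move=> S0 SN szS sS; split.
  apply/(all_nthP 0%N) => i; rewrite size_mkseq => iS; rewrite nth_mkseq // subn_gt0.
  by apply: (sorted_ltn_nth ltn_trans 0%N sS); rewrite ?inE //; lia.
have szg : size (gaps S) = (size S).-1 by rewrite size_mkseq.
by rewrite -[gaps S]take_size -nth_partial_sums // partial_sums_gaps // szg.
Qed.

Lemma is_partition_parts_between (N : nat) (p : seq nat) (a b : nat) :
  is_partition N p -> a \in partial_sums p -> b \in partial_sums p ->
  (a <= b)%N -> is_partition (b - a) (parts_between p a b) /\
    forall k, k \in partial_sums (parts_between p a b) ->
      (k <= b - a)%N /\ (a + k)%N \in partial_sums p.
Proof.
move=> [p0 _] /partial_sumsP[c cp ->] /partial_sumsP[d dp ->].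
rewrite leq_sumn_take // => cd; rewrite parts_betweenE //; split; first split.
- by apply/allP => x /mem_take/mem_drop; exact: (allP p0).
- exact: sumn_slice.
- move=> k kp; split; last exact: mem_partial_sums_slice kp.
  rewrite -sumn_slice //; case/partial_sumsP: kp => t _ ->.
  by rewrite -[X in (_ <= sumn X)%N](cat_take_drop t) sumn_cat leq_addr.
Qed.

(** A common partial sum [k] of the two slices gives a member [a + k] of [S] with [a <= a + k <= b].
    As [a] and [b] are consecutive in [S], it is one of the two. *)
Lemma non_commensurable_between (N : nat) (p q : seq nat) (l : nat) :
  is_partition N p -> is_partition N q ->
  let S := common_sums p q in
  (1 <= l <= (size S).-1)%N ->
  let a := nth 0%N S l.-1 in let b := nth 0%N S l in
  non_commensurable (b - a) (parts_between p a b) (parts_between q a b).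
Proof.
move=> hp hq S /andP[l1 lS] a b.
have [S0 SN sS szS] := common_sumsE hp hq.
rewrite -/S in S0 SN sS szS.
have lt i j := sorted_ltn_nth ltn_trans 0%N sS i j.
have lS1 : (l.-1 < size S)%N by lia.
have {}lS : (l < size S)%N by lia.
have ab : (a < b)%N by apply: lt; rewrite ?inE //; lia.
have [aS bS] : a \in S /\ b \in S by split; apply: mem_nth.
move: (aS) (bS); rewrite !mem_filter => /andP[aq ap] /andP[bq bp].
have [pab pk] := is_partition_parts_between hp ap bp (ltnW ab).
have [qab qk] := is_partition_parts_between hq aq bq (ltnW ab).
split => // k /pk[kab akp] /qk[_ akq].
have : (a + k)%N \in S by rewrite mem_filter akp akq.
case/(nthP 0%N) => i iS aki.
case: (ltngtP i l) => [il|li|E]; last by right; move: aki; rewrite E -/b; lia.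
  move: il; rewrite -(prednK l1) ltnS leq_eqVlt => /predU1P[E|il].
    by left; move: aki; rewrite E -/a -[LHS]addn0 => /addnI.
  by have := lt _ _ iS lS1 il; rewrite -/a aki ltnNge leq_addr.
by have := lt _ _ lS iS li; rewrite -/b aki; lia.
Qed.

(** * Plane rotations and coordinate reflections *)

Definition givens_entry (R : realType) (k : nat) (c s : R) (i j : nat) : R :=
  if i == k then if j == k then c else if j == k.+1 then s else 0
  else if i == k.+1 then if j == k then - s else if j == k.+1 then c else 0
  else (i == j)%:R.

(** The Givens rotation in the plane of coordinates [k] and [k.+1], once [c ^+ 2 + s ^+ 2 = 1] and
    [k.+1 < n]. Its entries depend on natural numbers only, so that rotations of different sizes can
    be compared without casts. *)
Definition givens (R : realType) (n k : nat) (c s : R) : 'M[R]_n :=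
  \matrix_(i, j) givens_entry k c s i j.

(** Both booleans are read as 0 or 1: this is the diagonal matrix that changes the sign of
    coordinate [k]. *)
Definition reflection (R : realType) (n k : nat) : 'M[R]_n :=
  \matrix_(i, j) ((-1) ^+ (i == k :> nat) *+ (i == j :> nat)).

Arguments reflection : clear implicits.

Lemma tr_givens (R : realType) (n k : nat) (c s : R) :
  (givens n k c s)^T = givens n k c (- s).
Proof.
apply/matrixP => i j; rewrite !mxE /givens_entry opprK.
by do !(case: eqP => ? //=); exfalso; lia.
Qed.

(** Peels off a leading coordinate that the rotation fixes. Together with [givens0] it brings a
    rotation down to size 2, and it also carries the induction on the size of a matrix. *)
Lemma givensS (R : realType) (n k : nat) (c s : R) :
  givens (1 + n) k.+1 c s = block_mx 1%:M 0 0 (givens n k c s).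
Proof.
apply/matrixP => i j; rewrite !mxE.
by case: splitP => i' ->; rewrite !mxE; case: splitP => j' ->;
  rewrite ?ord1 ?mxE /givens_entry /= ?if_same.
Qed.

Lemma givens0 (R : realType) (n : nat) (c s : R) :
  givens (2 + n) 0 c s = block_mx (givens 2 0 c s) 0 0 1%:M.
Proof.
apply/matrixP => i j; rewrite !mxE.
case: splitP => i' ->; rewrite !mxE; case: splitP => j' ->; rewrite ?mxE //.
  by case: i' => -[|[|]].
by case: j' => -[|[|]].
Qed.

Lemma block_mx_special_orthogonal (R : realType) (m n : nat)
    (A : 'M[R]_m) (B : 'M[R]_n) :
  special_orthogonal_group R m A -> special_orthogonal_group R n B ->
  special_orthogonal_group R (m + n) (block_mx A 0 0 B).
Proof.
move=> [AA dA] [BB dB]; split; last by rewrite det_ublock dA dB mulr1.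
rewrite tr_block_mx mulmx_block AA BB !trmx0 !mulmx0 !mul0mx !addr0 !add0r.
by rewrite -scalar_mx_block.
Qed.

Lemma special_orthogonal1 (R : realType) (n : nat) :
  special_orthogonal_group R n 1%:M.
Proof. by split; rewrite ?trmx1 ?mulmx1 ?det1. Qed.

Lemma special_orthogonalM (R : realType) (n : nat) (A B : 'M[R]_n) :
  special_orthogonal_group R n A -> special_orthogonal_group R n B ->
  special_orthogonal_group R n (A *m B).
Proof.
move=> [AA dA] [BB dB]; split; last by rewrite det_mulmx dA dB mulr1.
by rewrite trmx_mul mulmxA -(mulmxA A) BB mulmx1.
Qed.

Lemma orthogonalM (R : realType) (n : nat) (A B : 'M[R]_n) :
  orthogonal_group R n A -> orthogonal_group R n B ->
  orthogonal_group R n (A *m B).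
Proof.
rewrite /orthogonal_group /= => AA BB.
by rewrite trmx_mul mulmxA -(mulmxA A) BB mulmx1.
Qed.

Lemma givens_special_orthogonal (R : realType) (n k : nat) (c s : R) :
  (k.+1 < n)%N -> c ^+ 2 + s ^+ 2 = 1 ->
  special_orthogonal_group R n (givens n k c s).
Proof.
move=> kn cs; elim: k n kn => [|k IH] [//|n] kn; last first.
  rewrite [givens _ _ _ _](givensS n).
  by apply: (@block_mx_special_orthogonal _ 1);
    [exact: special_orthogonal1|exact: IH].
case: n kn => [//|n] _; rewrite [givens _ _ _ _](givens0 n).
apply: (@block_mx_special_orthogonal _ 2); last exact: special_orthogonal1.
split.
  rewrite tr_givens; apply/matrixP => i j.
  rewrite !mxE !big_ord_recl big_ord0 !mxE /givens_entry /=.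
  by case: i => -[|[|//]] ?; case: j => -[|[|//]] ? /=; nra.
rewrite (expand_det_row _ ord0) !big_ord_recl big_ord0 /cofactor !det_mx11 !mxE.
by rewrite /givens_entry /=; nra.
Qed.

Lemma reflection_orthogonal (R : realType) (n k : nat) :
  orthogonal_group R n (reflection R n k).
Proof.
apply/matrixP => i j; rewrite !mxE (bigD1 i) //= big1 ?addr0 => [|l li]; last first.
  by rewrite !mxE val_eqE (eq_sym i) (negbTE li) mulr0n mul0r.
rewrite !mxE eqxx mulr1n; case: (eqVneq i j) => [->|ij].
  by rewrite eqxx mulr1n -expr2 sqrr_sign.
by rewrite val_eqE (eq_sym j) (negbTE ij) mulr0n mulr0.
Qed.

Lemma det_reflection (R : realType) (n k : nat) :
  (k < n)%N -> \det (reflection R n k) = -1.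
Proof.
move=> kn; rewrite det_trig; last first.
  by apply/is_trig_mxP => i j ij; rewrite !mxE (ltn_eqF ij).
rewrite (bigD1 (Ordinal kn)) //= !mxE !eqxx big1 ?mulr1 // => i ik.
by rewrite !mxE eqxx -[k]/(val (Ordinal kn)) val_eqE (negbTE ik).
Qed.

(** * Row reduction: rotations and reflections generate the full groups *)

Lemma mul_row_givens (R : realType) (n : nat) (v : 'rV[R]_n) (i j : 'I_n)
    (c s : R) :
  j = i.+1 :> nat ->
  [/\ (v *m givens n i c s) 0 i = v 0 i * c - v 0 j * s,
      (v *m givens n i c s) 0 j = v 0 i * s + v 0 j * c &
      forall l, l != i -> l != j -> (v *m givens n i c s) 0 l = v 0 l].
Proof.
move=> ji.
have ij : j != i by rewrite -val_eqE /= ji; lia.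
have E (l l' : 'I_n) : givens_entry i c s l l' =
    if l == i then if l' == i then c else if l' == j then s else 0
    else if l == j then if l' == i then - s else if l' == j then c else 0
    else (l == l')%:R by rewrite /givens_entry -ji !val_eqE.
split=> [||l li lj]; rewrite mxE.
- rewrite (bigD1 i) // (bigD1 j) //= big1 => [|a /andP[ai aj]]; last first.
    by rewrite mxE E (negbTE ai) (negbTE aj) mulr0.
  by rewrite !mxE !E !eqxx (negbTE ij) addr0 mulrN.
- rewrite (bigD1 i) // (bigD1 j) //= big1 => [|a /andP[ai aj]]; last first.
    by rewrite mxE E (negbTE ai) (negbTE aj) mulr0.
  by rewrite !mxE !E !eqxx (negbTE ij) addr0.
- rewrite (bigD1 l) //= big1 => [|a al]; rewrite mxE E.
    by rewrite (negbTE li) (negbTE lj) eqxx mulr1 addr0.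
  by rewrite (negbTE li) (negbTE lj) (negbTE al) !if_same mulr0.
Qed.

(** Besides clearing the second coordinate, the rotation makes the first one nonnegative; this sign
    later rules out the value -1 for the entry left in a unit row. *)
Lemma exists_rotation (R : realType) (a b : R) :
  exists c s, [/\ c ^+ 2 + s ^+ 2 = 1, a * s + b * c = 0 & 0 <= a * c - b * s].
Proof.
have [ab0|ab0] := eqVneq (a ^+ 2 + b ^+ 2) 0.
  move/eqP: ab0; rewrite paddr_eq0 ?sqr_ge0 // !sqrf_eq0 => /andP[/eqP -> /eqP ->].
  by exists 1, 0; split; rewrite ?mul0r ?addr0 ?subr0 ?expr1n ?expr0n ?addr0.
pose r := Num.sqrt (a ^+ 2 + b ^+ 2).
have rr : r ^+ 2 = a ^+ 2 + b ^+ 2 by rewrite sqr_sqrtr // addr_ge0 ?sqr_ge0.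
have r0 : r != 0 by rewrite -sqrf_eq0 rr.
(* With these values the new first coordinate is the norm [r] of the pair. *)
exists (a / r), (- b / r); split.
- by rewrite !expr_div_n sqrrN -mulrDl -rr divff // sqrf_eq0.
- by rewrite !mulrA -mulrDl mulrN [b * a]mulrC addNr mul0r.
- rewrite !mulrA -mulrBl mulrN opprK -!expr2 -rr expr2 mulfK //.
  exact: sqrtr_ge0.
Qed.

(** The entries of [v] are cleared from the last one backwards, one rotation of adjacent coordinates
    for each. Membership is recorded for [A^T], the inverse of [A], because [P] is not assumed
    closed under inverses and it is the inverse that restores the original matrix. The sign is known
    only after at least one rotation, whence [0 < d]. *)
Lemma row_givens_reduction (R : realType) (n : nat) (P : set 'M[R]_n)
    (v : 'rV[R]_n) :
  P 1%:M -> (forall A B, P A -> P B -> P (A *m B)) ->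
  (forall k c s, (k.+1 < n)%N -> c ^+ 2 + s ^+ 2 = 1 -> P (givens n k c s)) ->
  forall d, (d < n)%N -> exists A,
    [/\ P A^T, special_orthogonal_group R n A,
        forall j : 'I_n, (n - d.+1 < j)%N -> (v *m A) 0 j = 0 &
        (0 < d)%N -> forall j : 'I_n, j = (n - d.+1)%N :> nat ->
          0 <= (v *m A) 0 j].
Proof.
move=> P1 PM Pg; elim=> [|d IH] dn.
  exists 1%:M; split=> //; first by rewrite trmx1.
    exact: special_orthogonal1.
  by move=> j; have := ltn_ord j; lia.
have [A [PA SA A0 _]] := IH (ltnW dn).
have in_ : (n - d.+2 < n)%N by lia.
have jn_ : (n - d.+1 < n)%N by lia.
pose i := Ordinal in_; pose j := Ordinal jn_.
have ji : j = i.+1 :> nat by rewrite /=; lia.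
have [c [s [cs e0 ge0]]] := exists_rotation ((v *m A) 0 i) ((v *m A) 0 j).
have [Ei Ej El] := mul_row_givens (v *m A) c s ji.
have ltin : (i.+1 < n)%N by rewrite -ji.
exists (A *m givens n i c s); split.
- rewrite trmx_mul tr_givens; apply: (PM) => //; apply: Pg => //.
  by rewrite sqrrN.
- by apply: special_orthogonalM => //; exact: givens_special_orthogonal.
- move=> l il; rewrite mulmxA; have [->|lj] := eqVneq l j; first by rewrite Ej.
  rewrite El // ?A0 //; last by rewrite -val_eqE /=; lia.
  by move: lj; rewrite -val_eqE /=; lia.
- move=> _ l li; have -> : l = i by apply: val_inj.
  by rewrite mulmxA Ei.
Qed.

(** The first row has norm 1 and a single entry that may be nonzero, so that entry is 1 or -1 and
    the sign decides. Orthogonality of the other rows to it then clears the first column. *)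
Lemma special_orthogonal_row0 (R : realType) (n : nat) (A : 'M[R]_(1 + n)) :
  special_orthogonal_group R (1 + n) A ->
  (forall j, j != 0 -> A 0 j = 0) -> ((0 < n)%N -> 0 <= A 0 0) ->
  A = block_mx 1%:M 0 0 (drsubmx A) /\
  special_orthogonal_group R n (drsubmx A).
Proof.
move=> [AA dA] A0j Age0; have A00 : A 0 0 = 1.
  (* In size 1 no sign is given, and the determinant provides the entry. *)
  case: n A AA dA A0j Age0 => [|n] A AA dA A0j Age0; first by rewrite -det_mx11.
  have /matrixP/(_ 0 0) := AA.
  rewrite !mxE (bigD1 0) //= mxE big1 ?addr0 => [|j j0]; last by rewrite A0j ?mul0r.
  move/eqP; rewrite -expr2 sqrf_eq1 => /orP[/eqP //|/eqP AN].
  by have := Age0 isT; rewrite AN ler0N1.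
have Ai0 i : i != 0 -> A i 0 = 0.
  move=> i0; have /matrixP/(_ i 0) := AA.
  rewrite !mxE (negbTE i0) (bigD1 0) //= !mxE A00 mulr1 big1 ?addr0 // => j j0.
  by rewrite mxE A0j // mulr0.
have E : A = block_mx 1%:M 0 0 (drsubmx A).
  rewrite -[LHS]submxK; congr block_mx; apply/matrixP => i j.
  - rewrite !mxE !ord1 -[RHS]A00; congr (A _ _); exact: val_inj.
  - rewrite !mxE ord1 (_ : lshift n 0 = 0) ?A0j //; exact: val_inj.
  - rewrite !mxE ord1 (_ : lshift n 0 = 0) ?Ai0 //; exact: val_inj.
split=> //; move: AA dA; rewrite E block_mxKdr; set B := drsubmx A => AA dA.
split; last by rewrite det_ublock det1 mul1r in dA.
move: AA; rewrite tr_block_mx mulmx_block !trmx0 !mulmx0 !mul0mx !addr0 !add0r.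
by rewrite scalar_mx_block => /eq_block_mx[].
Qed.

(* Rotating the first row of a matrix onto the first basis vector reduces the
   size by one. *)
Lemma special_orthogonal_generated (R : realType) (n : nat) (P : set 'M[R]_n) :
  P 1%:M -> (forall A B, P A -> P B -> P (A *m B)) ->
  (forall k c s, (k.+1 < n)%N -> c ^+ 2 + s ^+ 2 = 1 -> P (givens n k c s)) ->
  special_orthogonal_group R n `<=` P.
Proof.
elim: n P => [|n IH] P P1 PM Pg A SA.
  by rewrite (_ : A = 1%:M) //; apply/matrixP => -[].
have [B [PB SB B0 Bge0]] := row_givens_reduction (row 0 A) P1 PM Pg (ltnSn n).
pose C : 'M[R]_(1 + n) := A *m B.
have SC : special_orthogonal_group R (1 + n) C by exact: special_orthogonalM.
have rowC j : C 0 j = (row 0 A *m B) 0 j by rewrite -row_mul [RHS]mxE.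
have C0 j : j != 0 -> C 0 j = 0.
  by move=> j0; rewrite rowC B0 // subnn lt0n.
have Cge0 : (0 < n)%N -> 0 <= C 0 0.
  by move=> n0; rewrite rowC Bge0 // subnn.
have [CE SD] := special_orthogonal_row0 SC C0 Cge0.
have -> : A = C *m B^T by rewrite -mulmxA SB.1 mulmx1.
apply: (PM _ _ _ PB); rewrite CE.
(* The induction hypothesis is used for the predicate of being in [P] after adding one fixed leading
   coordinate; a rotation at [k] becomes one at [k.+1]. *)
apply: (IH (fun D => P (block_mx 1%:M 0 0 D : 'M[R]_(1 + n)))) SD.
- by rewrite -scalar_mx_block.
- move=> D E PD PE; have := PM _ _ PD PE.
  by rewrite (@mulmx_block _ 1 n 1 n 1 n) !mulmx0 !mul0mx !addr0 !add0r mulmx1.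
- by move=> k c s kn cs; rewrite -givensS; exact: Pg.
Qed.

(** A matrix of determinant -1 is a special orthogonal matrix times one reflection, and the
    reflection is its own inverse. *)
Lemma orthogonal_generated (R : realType) (n : nat) (P : set 'M[R]_n) :
  P 1%:M -> (forall A B, P A -> P B -> P (A *m B)) ->
  (forall k c s, (k.+1 < n)%N -> c ^+ 2 + s ^+ 2 = 1 -> P (givens n k c s)) ->
  (forall k, (k < n)%N -> P (reflection R n k)) ->
  orthogonal_group R n `<=` P.
Proof.
move=> P1 PM Pg Pr A OA; have SP := special_orthogonal_generated P1 PM Pg.
have : \det A ^+ 2 == 1 by rewrite expr2 -{2}det_tr -det_mulmx OA det1.
rewrite sqrf_eq1 => /orP[/eqP dA|/eqP dA]; first by apply: SP; split.
(* The empty matrix has determinant 1, so determinant -1 leaves room for coordinate 0. *)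
have n0 : (0 < n)%N.
  case: n A {P P1 PM Pg Pr SP OA} dA => // A.
  by rewrite det_mx00; lra.
have OR := reflection_orthogonal R n 0.
have tR : (reflection R n 0)^T = reflection R n 0.
  apply/matrixP => i j; rewrite !mxE; have [->//|ij] := eqVneq i j.
  by rewrite !val_eqE (eq_sym j) (negbTE ij) !mulr0n.
have -> : A = A *m reflection R n 0 *m reflection R n 0.
  by rewrite -mulmxA -{2}tR OR mulmx1.
apply: PM; last exact: Pr.
apply: SP; split; first by apply: orthogonalM.
by rewrite det_mulmx det_reflection // dA mulrNN mulr1.
Qed.

(** * Block-diagonal matrices and their one-block factors *)

Section BlockDiagonal.
Variables (R : realType) (p : seq nat).

Local Notation p_ := (fun i : 'I_(size p) => nth 0%N p i).
Local Notation sp := (\sum_(i < size p) nth 0%N p i)%N.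
Local Notation rank := (@tagnat.Rank (size p) p_ _).
Implicit Types (B : forall i : 'I_(size p), 'M[R]_(nth 0%N p i)).

(** At size [sp] the transport is the identity. Later proofs first replace [N] by this sum in order
    to drop the cast. *)
Lemma block_productE (G : forall n, set 'M[R]_n) (A : 'M[R]_sp) :
  block_product G sp p A <-> exists B, (forall i, G _ (B i)) /\ A = \mxdiag_i B i.
Proof.
split=> [[e [B [GB ->]]]|[B [GB ->]]]; last by exists erefl, B; rewrite castmx_id.
by exists B; rewrite castmx_id.
Qed.

Lemma mul_mxdiag B B' :
  \mxdiag_i B i *m \mxdiag_i B' i = \mxdiag_i (B i *m B' i).
Proof.
rewrite {2}/mxdiag mul_mxdiag_mxblock; apply/eq_mxblock => i j.
by case: eqVneq => [<-|_]; rewrite ?conform_mx_id ?mulmx0.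
Qed.

Lemma mxdiag_entry B (i : 'I_(size p)) (a b : 'I_(nth 0%N p i)) :
  (\mxdiag_i B i) (rank a) (rank b) = B i a b.
Proof. by have /matrixP/(_ a b) := submxblock_diag B i; rewrite mxE. Qed.

Lemma mxdiag_entry0 B (i j : 'I_(size p)) (a : 'I_(nth 0%N p i))
    (b : 'I_(nth 0%N p j)) :
  i != j -> (\mxdiag_i B i) (rank a) (rank b) = 0.
Proof.
move=> ij; have /matrixP/(_ a b) := mxblockK
  (fun i j => if i == j then conform_mx (0 : 'M[R]_(p_ i, p_ j)) (B i) else 0) i j.
by rewrite (negbTE ij) !mxE.
Qed.

(** Here [conform_mx] only gives [M] the type of the block [j]: the sizes agree when [j == i], and
    then it returns [M]. *)
Definition mxdiag_single (i : 'I_(size p)) (M : 'M[R]_(nth 0%N p i)) : 'M[R]_sp :=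
  \mxdiag_j (if j == i then conform_mx 1%:M M else 1%:M).

Lemma mxdiag_single1 (i : 'I_(size p)) :
  mxdiag_single (1%:M : 'M[R]_(nth 0%N p i)) = 1%:M.
Proof.
rewrite -mxdiagZ; apply/eq_mxdiag => j.
by case: eqVneq => [->|]; rewrite ?conform_mx_id.
Qed.

Lemma mxdiag_singleM (i : 'I_(size p)) (M M' : 'M[R]_(nth 0%N p i)) :
  mxdiag_single (M *m M') = mxdiag_single M *m mxdiag_single M'.
Proof.
rewrite mul_mxdiag; apply/eq_mxdiag => j.
by case: eqVneq => [->|]; rewrite ?conform_mx_id ?mulmx1.
Qed.

Lemma mxdiag_single_mem (P : set 'M[R]_sp) B :
  P 1%:M -> (forall A A', P A -> P A' -> P (A *m A')) ->
  (forall i, P (mxdiag_single (B i))) -> P (\mxdiag_i B i).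
Proof.
move=> P1 PM PB.
(* The product of the first [t] one-block factors, built up one factor at a time. *)
have PBt t : (t <= size p)%N ->
    P (\mxdiag_i (if (i < t)%N then B i else 1%:M)).
  elim: t => [|t IH] tp; first by rewrite mxdiagZ.
  have := PM _ _ (IH (ltnW tp)) (PB (Ordinal tp)).
  rewrite mul_mxdiag; congr P; apply/eq_mxdiag => i.
  have [->|it] := eqVneq i (Ordinal tp).
    by rewrite ltnn leqnn conform_mx_id mul1mx.
  have {}it : (i == t :> nat) = false.
    by apply: contra_neqF it => /eqP ?; exact: val_inj.
  by rewrite mulmx1 [in RHS]ltnS [in RHS]leq_eqVlt it.
have := PBt _ (leqnn _); congr P; apply/eq_mxdiag => i.
by rewrite ltn_ord.
Qed.

Lemma sum_lt_part (i : nat) :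
  (\sum_(k < size p | (k < i)%N) nth 0%N p k)%N = sumn (take i p).
Proof.
elim: p i => [|x q IH] [|i]; rewrite ?big_ord0 //; first by rewrite big_pred0.
by rewrite big_mkcond big_ord_recl /= -big_mkcond IH.
Qed.

Lemma val_Rank (i : 'I_(size p)) (a : 'I_(nth 0%N p i)) :
  rank a = (sumn (take i p) + a)%N :> nat.
Proof. by rewrite tagnat.RankEsum sum_lt_part. Qed.

Lemma mxdiag_single_givens (i : 'I_(size p)) (k : nat) (c s : R) :
  (k.+1 < nth 0%N p i)%N ->
  mxdiag_single (givens (nth 0%N p i) k c s) = givens sp (sumn (take i p) + k) c s.
Proof.
move=> kp; pose k0 := Ordinal (ltnW kp); pose k1 := Ordinal kp.
(* Global indices are written as block number and local index; the tests in [givens_entry] then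
   become a test on the block and a test inside it. *)
have eqR (j : 'I_(size p)) (a : 'I_(nth 0%N p j)) (b : 'I_(nth 0%N p i)) :
    (rank a == (sumn (take i p) + b)%N :> nat) =
    (j == i) && (a == b :> nat).
  by rewrite -val_Rank tagnat.eq_Rank.
apply/matrixP => x y; rewrite -[x]tagnat.sig2K -[y]tagnat.sig2K.
move: (tagnat.sig1 x) (tagnat.sig2 x) (tagnat.sig1 y) (tagnat.sig2 y).
move=> {x y} j a j' b; rewrite [RHS]mxE /givens_entry -addnS.
rewrite !(eqR _ _ k0) !(eqR _ _ k1) tagnat.eq_Rank.
have [jj'|jj'] := eqVneq j j'; last first.
  rewrite mxdiag_entry0 //.
  case ji: (j == i); case j'i: (j' == i); rewrite /= ?if_same //.
  by case/eqP: jj'; rewrite (eqP ji) (eqP j'i).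
move: jj' b => <- b; rewrite mxdiag_entry.
have [ji|ji] := eqVneq j i; last by rewrite mxE.
by move: ji a b => -> a b; rewrite conform_mx_id mxE.
Qed.

Lemma mxdiag_single_reflection (i : 'I_(size p)) (k : nat) :
  (k < nth 0%N p i)%N ->
  mxdiag_single (reflection R (nth 0%N p i) k) =
  reflection R sp (sumn (take i p) + k).
Proof.
move=> kp; pose k0 := Ordinal kp.
apply/matrixP => x y; rewrite -[x]tagnat.sig2K -[y]tagnat.sig2K.
move: (tagnat.sig1 x) (tagnat.sig2 x) (tagnat.sig1 y) (tagnat.sig2 y).
move=> {x y} j a j' b; rewrite [RHS]mxE -[k]/(val k0) -val_Rank !tagnat.eq_Rank.
have [jj'|jj'] := eqVneq j j'; last by rewrite mxdiag_entry0.
move: jj' b => <- b; rewrite mxdiag_entry.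
have [ji|ji] := eqVneq j i; last by rewrite mxE.
by move: ji a b => -> a b; rewrite conform_mx_id mxE.
Qed.

End BlockDiagonal.

(** * Generators of a block product *)

Lemma part_containing (p : seq nat) (k : nat) :
  (k < sumn p)%N ->
  exists i : 'I_(size p), exists2 a, (a < nth 0%N p i)%N &
    k = (sumn (take i p) + a)%N.
Proof.
elim: p k => [//|x p IH] k kp.
rewrite -[sumn _]/(x + sumn p)%N in kp.
case: (ltnP k x) => [kx|xk]; first by exists ord0, k.
have [|i [a ap ka]] := IH (k - x)%N; first by lia.
by exists (lift ord0 i), a => //=; rewrite -addnA -ka subnKC.
Qed.

Lemma sumn_take_part (p : seq nat) (i : 'I_(size p)) :
  sumn (take i.+1 p) = (sumn (take i p) + nth 0%N p i)%N.
Proof. by rewrite (take_nth 0%N) ?sumn_rcons. Qed.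

(** The number lies strictly between the consecutive partial sums at [i] and [i.+1]. *)
Lemma inside_part (p : seq nat) (i : 'I_(size p)) (k : nat) :
  all (fun n => 0 < n)%N p -> (k.+1 < nth 0%N p i)%N ->
  (sumn (take i p) + k).+1 \notin partial_sums p.
Proof.
move=> p0 kp; apply/negP => /partial_sumsP[c cp E].
have [ci|ic] := leqP c i.
  have : (sumn (take c p) <= sumn (take i p))%N.
    by rewrite leq_sumn_take // ltnW.
  by rewrite -E; lia.
have : (sumn (take i.+1 p) <= sumn (take c p))%N by rewrite leq_sumn_take.
by rewrite -E sumn_take_part; lia.
Qed.

Lemma sumn_ord (p : seq nat) : (\sum_(i < size p) nth 0 p i)%N = sumn p.
Proof. by rewrite sumnE (big_nth 0%N) big_mkord. Qed.

Section BlockProductGenerators.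
Variables (R : realType) (N : nat) (p : seq nat).
Hypothesis hp : is_partition N p.

(** Coordinates are counted from 0, so the cut between [k] and [k.+1] is the partial sum [k.+1];
    without that cut both coordinates belong to the same part. *)
Lemma block_product_givens (k : nat) (c s : R) :
  (k.+1 < N)%N -> k.+1 \notin partial_sums p -> c ^+ 2 + s ^+ 2 = 1 ->
  block_product (special_orthogonal_group R) N p (givens N k c s).
Proof.
case: hp => p0 pN; rewrite -pN => kN kp cs.
have [i [a ap E]] := part_containing (ltnW kN).
(* If [a] were the last place of part [i], that part would end at the cut [k.+1]. *)
have {}ap : (a.+1 < nth 0%N p i)%N.
  rewrite ltn_neqAle ap andbT; apply: contra kp => /eqP ap'.
  apply/partial_sumsP; exists i.+1 => //.
  by rewrite sumn_take_part -ap' addnS -E.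
rewrite -sumn_ord E -mxdiag_single_givens //; apply/block_productE.
eexists; split; last reflexivity; move=> j /=.
case: eqVneq => [->|_]; last exact: special_orthogonal1.
by rewrite conform_mx_id; exact: givens_special_orthogonal.
Qed.

Lemma block_product_reflection (k : nat) :
  (k < N)%N -> block_product (orthogonal_group R) N p (reflection R N k).
Proof.
case: hp => p0 pN; rewrite -pN => kN.
have [i [a ap ->]] := part_containing kN.
rewrite -sumn_ord -mxdiag_single_reflection //; apply/block_productE.
eexists; split; last reflexivity; move=> j /=.
case: eqVneq => [->|_]; last by case: (special_orthogonal1 R (nth 0%N p j)).
by rewrite conform_mx_id; exact: reflection_orthogonal.
Qed.

Lemma special_block_product_sub :
  block_product (special_orthogonal_group R) N p `<=`
  block_product (orthogonal_group R) N p.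
Proof. by move=> A [e [B [SB ->]]]; exists e, B; split=> // i; have [] := SB i. Qed.

Lemma special_block_product_generated (P : set 'M[R]_N) :
  P 1%:M -> (forall A B, P A -> P B -> P (A *m B)) ->
  (forall k c s, (k.+1 < N)%N -> k.+1 \notin partial_sums p ->
    c ^+ 2 + s ^+ 2 = 1 -> P (givens N k c s)) ->
  block_product (special_orthogonal_group R) N p `<=` P.
Proof.
case: hp => p0 pN; move: P; rewrite -pN -sumn_ord => P P1 PM Pg A.
move=> /block_productE[B [SB ->]]; apply: mxdiag_single_mem => // i.
(* The generation result for one block is applied to the pullback of [P] along [mxdiag_single]. *)
apply: (special_orthogonal_generated
  (P := fun M => P (mxdiag_single M))) (SB i).
- by rewrite mxdiag_single1.
- by move=> M M' PM1 PM2; rewrite mxdiag_singleM; exact: PM.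
- move=> k c s kp cs; rewrite mxdiag_single_givens //; apply: Pg => //.
    rewrite sumn_ord -addnS -{3}(take_size p).
    rewrite (@leq_trans (sumn (take i.+1 p))) ?leq_sumn_take //.
    by rewrite sumn_take_part ltn_add2l.
  exact: inside_part.
Qed.

Lemma block_product_generated (P : set 'M[R]_N) :
  P 1%:M -> (forall A B, P A -> P B -> P (A *m B)) ->
  (forall k c s, (k.+1 < N)%N -> k.+1 \notin partial_sums p ->
    c ^+ 2 + s ^+ 2 = 1 -> P (givens N k c s)) ->
  (forall k, (k < N)%N -> P (reflection R N k)) ->
  block_product (orthogonal_group R) N p `<=` P.
Proof.
move=> P1 PM Pg Pr; have PS := special_block_product_generated P1 PM Pg.
case: hp => p0 pN; move: P P1 PM Pg Pr PS; rewrite -pN -sumn_ord.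
move=> P P1 PM Pg Pr PS A /block_productE[B [OB ->]].
apply: mxdiag_single_mem => // i.
have P1i : P (mxdiag_single (1%:M : 'M[R]_(nth 0%N p i))) by rewrite mxdiag_single1.
apply: (orthogonal_generated (P := fun M => P (mxdiag_single M))) (OB i) => //.
- by move=> M M' PM1 PM2; rewrite mxdiag_singleM; exact: PM.
(* A rotation inside one block is in the special block product, which [PS] places in [P]. *)
- move=> k c s kp cs; apply: PS; apply/block_productE.
  eexists; split; last reflexivity; move=> j /=.
  case: eqVneq => [->|_]; last exact: special_orthogonal1.
  by rewrite conform_mx_id; exact: givens_special_orthogonal.
- move=> k kp; rewrite mxdiag_single_reflection //; apply: Pr.
  rewrite sumn_ord -{3}(take_size p).
  rewrite (@leq_trans (sumn (take i.+1 p))) ?leq_sumn_take //.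
  by rewrite sumn_take_part ltn_add2l.
Qed.

End BlockProductGenerators.

(** * Block products are closed subgroups *)

Lemma continuous_sum (R : realType) (T : topologicalType) (I : Type)
    (r : seq I) (F : I -> T -> R) :
  (forall i, continuous (F i)) -> continuous (fun x => \sum_(i <- r) F i x).
Proof. by move=> cF; apply: continuous_big => //; exact: add_continuous. Qed.

Lemma continuous_prod (R : realType) (T : topologicalType) (I : Type)
    (r : seq I) (F : I -> T -> R) :
  (forall i, continuous (F i)) -> continuous (fun x => \prod_(i <- r) F i x).
Proof. by move=> cF; apply: continuous_big => //; exact: mul_continuous. Qed.

Lemma closed_forall_eq (R : realType) (T : topologicalType) (I : Type)
    (F : I -> T -> R) (a : I -> R) :
  (forall i, continuous (F i)) -> closed [set x | forall i, F i x = a i].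
Proof.
move=> cF.
have -> : [set x | forall i, F i x = a i] =
    \bigcap_(i in [set: I]) (F i @^-1` [set y | y = a i]).
  by apply/seteqP; split=> x /= Fx i; [move=> _; exact: Fx|exact: (Fx i Logic.I)].
apply: closed_bigI => i _; apply: preimage_closed; last exact: closed_eq.
by move=> x _; exact: cF.
Qed.

(** The parameter space [T] allows [f] to be the extraction of a diagonal block from a larger
    matrix. *)
Lemma closed_orthogonal (R : realType) (T : topologicalType) (n : nat)
    (f : T -> 'M[R]_n) :
  (forall i j, continuous (fun x => f x i j)) ->
  closed [set x | orthogonal_group R n (f x)].
Proof.
move=> cf.
have -> : [set x | orthogonal_group R n (f x)] =
    [set x | forall ij : 'I_n * 'I_n,
      \sum_k f x ij.1 k * f x ij.2 k = (1%:M : 'M[R]_n) ij.1 ij.2].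
  apply/seteqP; split=> x /= Ox.
    move=> [i j]; rewrite -Ox mxE; apply: eq_bigr => k _; by rewrite mxE.
  apply/matrixP => i j; rewrite -(Ox (i, j)) mxE.
  by apply: eq_bigr => k _; rewrite mxE.
apply: closed_forall_eq => -[i j]; apply: continuous_sum => k x.
by apply: continuousM; exact: cf.
Qed.

Lemma closed_special_orthogonal (R : realType) (T : topologicalType) (n : nat)
    (f : T -> 'M[R]_n) :
  (forall i j, continuous (fun x => f x i j)) ->
  closed [set x | special_orthogonal_group R n (f x)].
Proof.
move=> cf.
(* The single equation on the determinant is indexed by [unit] to fit [closed_forall_eq]. *)
have -> : [set x | special_orthogonal_group R n (f x)] =
    [set x | orthogonal_group R n (f x)] `&`
    [set x | forall _ : unit, \det (f x) = 1].
  by apply/seteqP; split=> x /= [Ox dx]; split=> //; exact: dx tt.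
apply: closedI; first exact: closed_orthogonal.
(* The determinant is read as its Leibniz sum over permutations. *)
apply: closed_forall_eq => _; apply: continuous_sum => s x.
apply: (@continuousM R T (fun=> (-1) ^+ perm.odd_perm s)
  (fun x => \prod_i f x i (perm.fun_of_perm s i))); first exact: cst_continuous.
by apply: continuous_prod => i; exact: cf.
Qed.

Lemma closed_subgroup_block_product (R : realType) (N : nat) (p : seq nat)
    (G : forall n, set 'M[R]_n) :
  is_partition N p ->
  (forall n, G n `<=` orthogonal_group R n) ->
  (forall n, G n 1%:M) ->
  (forall n A B, G n A -> G n B -> G n (A *m B)) ->
  (forall n A, G n A -> G n A^T) ->
  (forall (T : topologicalType) n (f : T -> 'M[R]_n),
    (forall i j, continuous (fun x => f x i j)) -> closed [set x | G n (f x)]) ->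
  closed_subgroup_O (block_product G N p).
Proof.
move=> [_ <-]; rewrite -sumn_ord => GO G1 GM GT Gc.
have subO : block_product G (\sum_(i < size p) nth 0 p i)%N p `<=`
    orthogonal_group R _.
  move=> A /block_productE[B [GB ->]].
  rewrite /orthogonal_group /= tr_mxdiag mul_mxdiag -mxdiagZ.
  by apply/eq_mxdiag => i; exact: GO.
split=> //.
- apply/block_productE; exists (fun=> 1%:M); split=> //.
  by rewrite mxdiagZ.
- move=> _ _ /block_productE[B [GB ->]] /block_productE[C [GC ->]].
  apply/block_productE; exists (fun i => B i *m C i); split; last exact: mul_mxdiag.
  by move=> i; exact: GM.
- move=> A GA; have AA := subO _ GA.
  have -> : invmx A = A^T.
    have [Au _] := mulmx1_unit AA.
    by rewrite -[RHS]mul1mx -(mulVmx Au) -mulmxA AA mulmx1.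
  case/block_productE: GA => B [GB ->]; apply/block_productE.
  exists (fun i => (B i)^T); split; last exact: tr_mxdiag.
  by move=> i; exact: GT.
(* Membership splits into two closed conditions: each diagonal block is in [G], and every entry
   whose row and column lie in different blocks is zero. *)
- have -> : block_product G (\sum_(i < size p) nth 0 p i)%N p =
      (\bigcap_(i in [set: 'I_(size p)]) [set A | G _ (submxblock A i i)]) `&`
      [set A | forall xy : {xy | tagnat.sig1 xy.1 != tagnat.sig1 xy.2},
        A (val xy).1 (val xy).2 = 0].
    apply/seteqP; split=> A.
      move=> /block_productE[B [GB ->]]; split.
        by move=> i _ /=; rewrite submxblock_diag.
      move=> [[x y] /= xy]; rewrite -[x]tagnat.sig2K -[y]tagnat.sig2K.
      exact: mxdiag_entry0.
    move=> [GA A0]; apply/block_productE; exists (fun i => submxblock A i i).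
    split; first by move=> i; exact: GA.
    apply/matrixP => x y.
    have [xy|xy] := eqVneq (tagnat.sig1 x) (tagnat.sig1 y); last first.
      rewrite (A0 (exist _ (x, y) xy)) -[x]tagnat.sig2K -[y]tagnat.sig2K.
      by rewrite mxdiag_entry0.
    rewrite -[x]tagnat.sig2K -[y]tagnat.sig2K.
    move: (tagnat.sig2 x) (tagnat.sig2 y); rewrite -xy => a b.
    by rewrite mxdiag_entry mxE.
  apply: closedI.
    apply: closed_bigI => i _; apply: Gc => a b A.
    rewrite (_ : (fun B => _) =
      fun B : 'M[R]__ => B (tagnat.Rank i a) (tagnat.Rank i b)).
      exact: coord_continuous.
    by apply/funext => B; rewrite mxE.
  by apply: closed_forall_eq => xy; exact: coord_continuous.
Qed.

Lemma topologically_generated_eq (R : realType) (N : nat) (H K L : set 'M[R]_N) :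
  closed_subgroup_O L -> H `<=` L -> K `<=` L ->
  (forall D, closed_subgroup_O D -> H `<=` D -> K `<=` D -> L `<=` D) ->
  topologically_generated H K = L.
Proof.
move=> cL HL KL LD; apply/seteqP; split.
  by apply: smallest_sub => // A [/HL|/KL].
move=> A LA D [cD HKD]; apply: LD LA => // B ?; apply: HKD; [left|right] => //.
Qed.

Lemma closed_subgroup_block_orthogonal (R : realType) (N : nat) (p : seq nat) :
  is_partition N p ->
  closed_subgroup_O (block_product (orthogonal_group R) N p).
Proof.
move=> hp; apply: closed_subgroup_block_product hp _ _ _ _ _ => //.
- by move=> n A.
- by move=> n; case: (special_orthogonal1 R n).
- by move=> n A B; exact: orthogonalM.
- by move=> n A /mulmx1C; rewrite /orthogonal_group /= trmxK.
- by move=> T n f; exact: closed_orthogonal.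
Qed.

Lemma closed_subgroup_block_special_orthogonal (R : realType) (N : nat)
    (p : seq nat) :
  is_partition N p ->
  closed_subgroup_O (block_product (special_orthogonal_group R) N p).
Proof.
move=> hp; apply: closed_subgroup_block_product hp _ _ _ _ _ => //.
- by move=> n A [].
- by move=> n; exact: special_orthogonal1.
- by move=> n A B; exact: special_orthogonalM.
- by move=> n A [/mulmx1C AA dA]; split; rewrite ?trmxK ?det_tr.
- by move=> T n f; exact: closed_special_orthogonal.
Qed.

(** * The closed groups generated by two block products *)

Theorem theorem5p4 (R : realType) (N : nat) (piH piK : seq nat)
    (hH : is_partition N piH) (hK : is_partition N piK)
    (sortedH : sorted leq piH) (sortedK : sorted leq piK) :
  let S := common_sums piH piK in
  let m := (size S).-1 in
  [/\ [/\ nth 0%N S 0 = 0%N, nth 0%N S m = N & sorted ltn S],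
      (forall l : nat, (1 <= l <= m)%N ->
         let a := nth 0%N S l.-1 in
         let b := nth 0%N S l in
         (parts_between piH a b = [:: (b - a)%N] /\
          parts_between piK a b = [:: (b - a)%N]) \/
         non_commensurable (b - a) (parts_between piH a b)
                                   (parts_between piK a b)),
      topologically_generated (block_product (orthogonal_group R) N piH)
                              (block_product (orthogonal_group R) N piK)
        = block_product (orthogonal_group R) N (gaps S) &
      topologically_generated (block_product (special_orthogonal_group R) N piH)
                              (block_product (special_orthogonal_group R) N piK)
        = block_product (special_orthogonal_group R) N (gaps S)].
Proof.
move=> S m; have [S0 SN sS szS] := common_sumsE hH hK.
rewrite -/S -/m in S0 SN sS szS.
have hg : is_partition N (gaps S) by exact: is_partition_gaps.
(* The cuts of [gaps S] are the common cuts, so a number that is not a cut of [gaps S] is missing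
   from [piH] or from [piK]. *)
have gE k : (k \in partial_sums (gaps S)) =
    (k \in partial_sums piH) && (k \in partial_sums piK).
  by rewrite partial_sums_gaps // mem_filter andbC.
have HS k : k \notin partial_sums piH -> k \notin partial_sums (gaps S).
  by rewrite gE negb_and => ->.
have KS k : k \notin partial_sums piK -> k \notin partial_sums (gaps S).
  by rewrite gE negb_and orbC => ->.
split.
- by split.
(* A single part equal in both partitions has only the partial sums 0 and [b - a], so the second
   alternative holds for every [l]. *)
- by move=> l lm; right; exact: non_commensurable_between hH hK lm.
- have cL := closed_subgroup_block_orthogonal R hg.
  have [_ L1 LM _ _] := cL.
  (* Fewer cuts mean larger blocks, so the generators for [p] stay in the product over the gaps. *)
  have sub p : is_partition N p ->
      (forall k, k \notin partial_sums p -> k \notin partial_sums (gaps S)) ->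
      block_product (orthogonal_group R) N p `<=`
      block_product (orthogonal_group R) N (gaps S).
    move=> hp pS; apply: block_product_generated => // [k c s kN kp cs|k kN].
      apply: special_block_product_sub.
      by apply: block_product_givens => //; exact: pS.
    exact: block_product_reflection.
  apply: topologically_generated_eq => //; [exact: sub|exact: sub|].
  move=> D [_ D1 DM _ _] HD KD.
  (* Reflections respect every partition and are taken from [H]; a rotation is taken from whichever
     group lacks the cut that it crosses. *)
  apply: block_product_generated => // [k c s kN|k kN]; last first.
    by apply: HD; exact: block_product_reflection.
  rewrite gE negb_and => /orP[kH|kK] cs; [apply: HD|apply: KD];
    by apply: special_block_product_sub; exact: block_product_givens.
- have cL := closed_subgroup_block_special_orthogonal R hg.
  have [_ L1 LM _ _] := cL.
  have sub p : is_partition N p ->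
      (forall k, k \notin partial_sums p -> k \notin partial_sums (gaps S)) ->
      block_product (special_orthogonal_group R) N p `<=`
      block_product (special_orthogonal_group R) N (gaps S).
    move=> hp pS; apply: special_block_product_generated => // k c s kN kp cs.
    by apply: block_product_givens => //; exact: pS.
  apply: topologically_generated_eq => //; [exact: sub|exact: sub|].
  move=> D [_ D1 DM _ _] HD KD.
  apply: special_block_product_generated => // k c s kN.
  rewrite gE negb_and => /orP[kH|kK] cs; [apply: HD|apply: KD];
    exact: block_product_givens.
Qed.
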